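(* Let $\theta\in\{0,3\}$ and let $\Theta_1=\{x\in[0,1]: \nu_i(x)\text{ exists for every } i\in\{0,1,2,3\}\text{ and } r(x)=\theta\}$. Then $\Theta_1$ is an anomalously fractal set (its Hausdorff--Besicovitch dimension equals $0$) and $\Theta_1$ is everywhere dense in $[0,1]$.
   Context: Every $x\in[0,1]$ is written in base $4$ as $x=\sum_{k\ge1}\alpha_k(x)4^{-k}$ with $\alpha_k(x)\in\{0,1,2,3\}$; for numbers with two representations one uses the one ending in the period $(0)$. For $i\in\{0,1,2,3\}$, $N_i(x,n)=\#\{j\le n:\alpha_j(x)=i\}$ and the frequency of the digit $i$ is $\nu_i(x)=\lim_{n\to\infty}N_i(x,n)/n$ (when the limit exists). The asymptotic mean of digits is $r(x)=\lim_{n\to\infty}\frac1n\sum_{k=1}^n\alpha_k(x)$ (when it exists). A set is called anomalously fractal if its Hausdorff--Besicovitch dimension is $0$. *)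

(* Defs.v *)
From mathcomp Require Import all_boot all_order all_algebra.
From mathcomp Require Import all_classical all_reals all_analysis.

Set Implicit Arguments.
Unset Strict Implicit.
Unset Printing Implicit Defensive.

Import Order.TTheory GRing.Theory Num.Theory.
Import numFieldNormedType.Exports.

Local Open Scope classical_set_scope.
Local Open Scope ring_scope.

(* Digit sequences are indexed from 0: a k stands for the digit alpha_{k+1},
   of weight 4^-(k+1). *)
Definition base4_expansion (R : realType) (x : R) (a : nat -> 'I_4) : Prop :=
  series (fun k => (a k)%:R / 4 ^+ k.+1) @ \oo --> x.

(* When x has several expansions, only the one ending in the period (0) is
   canonical. The number 1 has the single expansion 0.(3). *)
Definition canonical_base4 (R : realType) (x : R) (a : nat -> 'I_4) : Prop :=
  base4_expansion x a /\
  ((exists2 b, base4_expansion x b & b <> a) ->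
   exists N, forall k, (N <= k)%N -> a k = ord0).

(* Meaningful for 0 <= x <= 1, where exactly one sequence is canonical; the
   default value is never used there. *)
Definition digit (R : realType) (x : R) : nat -> 'I_4 :=
  xget (fun=> ord0) [set a | canonical_base4 x a].

Definition digit_count (R : realType) (i : 'I_4) (x : R) (n : nat) : nat :=
  #|[pred j : 'I_n | digit x j == i]|.

Definition digit_freq_seq (R : realType) (i : 'I_4) (x : R) : nat -> R :=
  fun n => (digit_count i x n)%:R / n%:R.

Definition digit_mean_seq (R : realType) (x : R) : nat -> R :=
  fun n => n%:R^-1 * \sum_(k < n) (digit x k)%:R.

Definition Theta1 (R : realType) (theta : R) : set R :=
  [set x | [/\ 0 <= x <= 1,
               forall i : 'I_4, cvgn (digit_freq_seq i x) &
               digit_mean_seq x @ \oo --> theta]].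

Local Open Scope ereal_scope.

Definition diam (R : realType) (U : set R) : \bar R :=
  ereal_sup [set (`|x - y|)%:E | x in U & y in U].

(* Empty members of the cover contribute nothing to the sum, whatever s >= 0;
   thus finite covers are allowed and the 0-dimensional Hausdorff measure is the
   counting measure (as 0 `^ 0 = 1). *)
Definition hausdorff_premeasure (R : realType) (s delta : R) (A : set R) :
    \bar R :=
  ereal_inf [set \sum_(0 <= i <oo | U i != set0) diam (U i) `^ s |
    U in [set U : nat -> set R |
      A `<=` \bigcup_i U i /\ forall i, diam (U i) <= delta%:E]].

Definition hausdorff_measure (R : realType) (s : R) (A : set R) : \bar R :=
  ereal_sup [set hausdorff_premeasure s delta A |
    delta in [set delta : R | (0 < delta)%R]].

Definition hausdorff_dim (R : realType) (A : set R) : \bar R :=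
  ereal_inf [set s%:E |
    s in [set s : R | (0 <= s)%R /\ hausdorff_measure s A = 0]].

Definition anomalously_fractal (R : realType) (A : set R) : Prop :=
  hausdorff_dim A = 0.

(* Main.v *)
(* As 0 and 3 are the extreme digits, r(x) = c for c in {0, 3} means exactly that
   the proportion of digits of x different from c tends to 0.

   Dimension: for every K and N, such an x lies in a cylinder of some rank n >= N
   given by a word with at most n/K letters different from c. With l = 4^-s < m < 1
   and K large, l^n is at most t^(number of letters <> c) m^n for such words
   (Chernoff's bound), and the latter sums over all words of length n to
   ((1 + 3t)m)^n, the general term of a convergent geometric series if t is small.

   Density: change the digits of a point beyond rank n to c, except at the ranks
   where the binary logarithm jumps, which get 3 - c. *)
Require Import Defs.
From mathcomp Require Import all_boot all_order all_algebra.
From mathcomp Require Import all_classical all_reals all_analysis.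
From mathcomp Require Import zify ring lra.
Set Implicit Arguments.
Unset Strict Implicit.
Unset Printing Implicit Defensive.

Import Order.TTheory GRing.Theory Num.Theory.
Import numFieldNormedType.Exports.
Local Open Scope classical_set_scope.
Local Open Scope ring_scope.

(** * Partial sums of base 4 series and expansions of points of [[0, 1]] *)

Definition psum (R : realType) (a : nat -> 'I_4) (n : nat) : R :=
  series (fun k => (a k)%:R / 4 ^+ k.+1) n.

Definition mesh (R : realType) (n : nat) : R := (4 ^+ n)^-1.

Lemma psum0 (R : realType) a : psum R a 0 = 0.
Proof. by rewrite /psum /series /= big_geq. Qed.

Lemma psumS (R : realType) a n :
  psum R a n.+1 = psum R a n + (a n)%:R * mesh R n.+1.
Proof. by rewrite /psum /series /= big_nat_recr. Qed.

Lemma eq_psum (R : realType) a b n :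
  (forall k, (k < n)%N -> a k = b k) -> psum R a n = psum R b n.
Proof.
move=> ab; rewrite /psum /series /=.
by apply: eq_big_nat => k /= kn; rewrite ab.
Qed.

Lemma mesh_gt0 (R : realType) n : 0 < mesh R n.
Proof. by rewrite invr_gt0 exprn_gt0. Qed.

Lemma meshS (R : realType) n : mesh R n = 4 * mesh R n.+1.
Proof. by rewrite /mesh exprS; field; rewrite expf_neq0. Qed.

Lemma mesh0 (R : realType) : mesh R 0 = 1.
Proof. by rewrite /mesh expr0 invr1. Qed.

Lemma digit_le3 (R : realType) (d : 'I_4) : (d%:R : R) <= 3.
Proof. by rewrite (ler_nat _ d 3) -ltnS. Qed.

Lemma psum_homo (R : realType) a :
  {homo psum R a : m n / (m <= n)%N >-> m <= n}.
Proof.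
apply: homo_leq => [//|y x z|n]; first exact: le_trans.
by rewrite psumS lerDl mulr_ge0// ltW// mesh_gt0.
Qed.

(** Right endpoints of nested cylinders decrease: a digit is at most 3, so
    [(a n + 1) * mesh R n.+1 <= mesh R n]. *)
Lemma psum_mesh_homo (R : realType) a m n :
  (m <= n)%N -> psum R a n + mesh R n <= psum R a m + mesh R m.
Proof.
elim: n => [|n ih]; first by rewrite leqn0 => /eqP ->.
rewrite leq_eqVlt => /orP[/eqP -> //|/ih]; apply: le_trans.
rewrite psumS (meshS R n); have := digit_le3 R (a n); have := mesh_gt0 R n.+1.
by move=> h1 h2; have := ler_wpM2r (ltW h1) h2; lra.
Qed.

Lemma cvg_mesh (R : realType) : mesh R @ \oo --> (0 : R).
Proof.
have -> : mesh R = (fun n => 4^-1 ^+ n) by apply/funext => n; rewrite exprVn.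
by apply: cvg_expr; rewrite ger0_norm; lra.
Qed.

Lemma mesh_lt (R : realType) (e : R) : 0 < e -> \forall n \near \oo, mesh R n < e.
Proof.
move=> e0; have /cvgrPdist_lt/(_ _ e0) := @cvg_mesh R.
by apply: filterS => n; rewrite sub0r normrN gtr0_norm// mesh_gt0.
Qed.

(** Replaces the limit by membership in nested closed intervals whose lengths tend to 0. Closedness
    on the right accommodates the period (3). *)
Lemma expansionP (R : realType) (x : R) a :
  base4_expansion x a <->
  forall n, psum R a n <= x <= psum R a n + mesh R n.
Proof.
split => [ax n|bnd].
  apply/andP; split.
  - have -> : x = limn (psum R a) by apply/esym/cvg_lim.
    by apply: nondecreasing_cvgn_le; [exact: psum_homo|apply/cvg_ex; exists x].
  - have xl : psum R a @ \oo --> x := ax.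
    have -> : x = limn (psum R a) by apply/esym/cvg_lim.
    apply: limr_le; first by apply/cvg_ex; exists x.
    exists n => // m /= nm; apply: le_trans (psum_mesh_homo R a nm).
    by rewrite lerDl ltW ?mesh_gt0.
rewrite /base4_expansion; apply/cvgrPdist_lt => e /mesh_lt.
apply: filterS => n; apply: le_lt_trans.
by have /andP[h1 h2] := bnd n; rewrite -/(psum R a n) ger0_norm; lra.
Qed.

Lemma expansion_cvg (R : realType) (a : nat -> 'I_4) :
  exists x : R, base4_expansion x a.
Proof.
have : cvgn (psum R a).
  apply: nondecreasing_is_cvgn; first exact: psum_homo.
  exists 1 => _ [n _ <-]; have := psum_mesh_homo R a (leq0n n).
  by rewrite psum0 mesh0 add0r; have := mesh_gt0 R n; lra.
by move=> /cvg_ex[x xa]; exists x.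
Qed.

Lemma expansion_itv (R : realType) (x : R) a :
  base4_expansion x a -> 0 <= x <= 1.
Proof. by move=> /expansionP/(_ 0%N); rewrite psum0 mesh0 add0r. Qed.

(** The last branch also covers [r = 1], which gets the digit 3 and the remainder 1, so that
    [[0, 1]] is stable. *)
Definition lead_digit (R : realType) (r : R) : 'I_4 :=
  if 4 * r < 1 then inord 0 else if 4 * r < 2 then inord 1
  else if 4 * r < 3 then inord 2 else inord 3.

Lemma lead_digitP (R : realType) (r : R) :
  0 <= r <= 1 -> 0 <= 4 * r - (lead_digit r)%:R <= 1.
Proof.
move=> /andP[r0 r1]; rewrite /lead_digit.
case: ltP => h1; first by rewrite inordK//; lra.
case: ltP => h2; first by rewrite inordK//; lra.
by case: ltP => h3; rewrite inordK//; lra.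
Qed.

Lemma expansion_exists (R : realType) (x : R) :
  0 <= x <= 1 -> exists a, base4_expansion x a.
Proof.
move=> x01; pose r n : R := iter n (fun r => 4 * r - (lead_digit r)%:R) x.
have r01 n : 0 <= r n <= 1 by elim: n => //= n; exact: lead_digitP.
exists (fun k => lead_digit (r k)); apply/expansionP => n.
set a := fun k => _.
(* [r n] is the part of [x] left after [n] digits, rescaled to [[0, 1]]. *)
have xE : x = psum R a n + r n * mesh R n.
  elim: n => [|n ih]; first by rewrite psum0 mesh0 add0r mulr1.
  by rewrite {1}ih psumS [mesh R n]meshS /=; ring.
have /andP[h1 h2] := r01 n; have m0 := mesh_gt0 R n.
rewrite xE; apply/andP; split.
  by rewrite lerDl mulr_ge0// ltW.
by rewrite lerD2l ler_piMl// ltW.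
Qed.

(** * Points with two expansions and the canonical one *)

Definition eventually_digit (d : nat) (a : nat -> 'I_4) :=
  exists N, forall k, (N <= k)%N -> a k = d :> nat.

Lemma first_difference (a b : nat -> 'I_4) : a <> b ->
  exists k, a k <> b k /\ forall j, (j < k)%N -> a j = b j.
Proof.
move=> ab; have ex : exists k, a k != b k.
  apply: contrapT => h; apply: ab; apply/funext => k.
  by apply/eqP; apply: contrapT => /negP kP; apply: h; exists k.
have [k kP kmin] := find_ex_minn ex; exists k; split; first exact/eqP.
by move=> j jk; apply/eqP; apply: contraTT jk => /kmin; rewrite -leqNgt.
Qed.

(** Past the first difference the cylinders of [a] and [b] can only share an endpoint. So [x] stays
    the right end for [a], forcing digits 3, and the left end for [b], forcing digits 0. *)
Lemma expansion_carry (R : realType) (x : R) a b k :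
    base4_expansion x a -> base4_expansion x b ->
    (forall j, (j < k)%N -> a j = b j) -> (a k < b k)%N ->
  eventually_digit 3 a /\ eventually_digit 0 b.
Proof.
move=> /expansionP ax /expansionP bx agree lt_ab.
have gap : psum R a k.+1 + mesh R k.+1 <= psum R b k.+1.
  rewrite !psumS (eq_psum R agree)// -addrA lerD2l.
  by rewrite -[X in _ + X]mul1r -mulrDl natr1 ler_pM2r ?mesh_gt0// ler_nat.
have tight n : (k < n)%N ->
    psum R b n = x /\ psum R a n + mesh R n = x.
  move=> kn; have := psum_homo R b kn; have := psum_mesh_homo R a kn.
  by have /andP[_] := ax n; have /andP[+ _] := bx n; move: gap; split; lra.
split; exists k.+1 => j kj; have [bj aj] := tight _ kj;
    have [bj' aj'] := tight _ (ltnW kj : (k < j.+1)%N); have m0 := mesh_gt0 R j.+1.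
  move: aj'; rewrite -aj psumS (meshS R j) => /eqP; rewrite -subr_eq0.
  have -> : psum R a j + (a j)%:R * mesh R j.+1 + mesh R j.+1 -
    (psum R a j + 4 * mesh R j.+1) = ((a j)%:R - 3) * mesh R j.+1 by ring.
  by rewrite mulf_eq0 (gt_eqF m0) orbF subr_eq0 eqr_nat => /eqP.
move: bj'; rewrite -bj psumS => /eqP; rewrite -subr_eq0 addrAC subrr add0r.
by rewrite mulf_eq0 (gt_eqF m0) orbF pnatr_eq0 => /eqP.
Qed.

Lemma expansion_ambiguous (R : realType) (x : R) a b :
    base4_expansion x a -> base4_expansion x b -> a <> b ->
  (eventually_digit 3 a /\ eventually_digit 0 b) \/
  (eventually_digit 3 b /\ eventually_digit 0 a).
Proof.
move=> ax bx /first_difference[k [abk agree]].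
have : (a k < b k)%N || (b k < a k)%N.
  by rewrite -neq_ltn; apply/eqP => /val_inj.
case/orP => lt_k; [left|right]; apply: (@expansion_carry R x _ _ k) => //.
by move=> j /agree.
Qed.

(** An expansion ending in (0) is chosen if there is one; otherwise [expansion_ambiguous] makes the
    expansion unique. *)
Lemma canonical_exists (R : realType) (x : R) :
  0 <= x <= 1 -> exists a, canonical_base4 x a.
Proof.
move=> /expansion_exists[a ax].
have [[b [bx [N bN]]]|none] :=
    pselect (exists b, base4_expansion x b /\ eventually_digit 0 b).
  by exists b; split=> // _; exists N => k /bN bk; exact: val_inj.
exists a; split=> // -[b bx ba]; exfalso; apply: none.
have [[_ h]|[_ h]] := expansion_ambiguous bx ax ba; last by exists b.
by exists a.
Qed.

Lemma digit_canonical (R : realType) (x : R) :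
  0 <= x <= 1 -> canonical_base4 x (digit x).
Proof. by move=> /canonical_exists/(xgetPex (fun=> ord0)). Qed.

Lemma digit_unique (R : realType) (x : R) a :
    base4_expansion x a -> ~ eventually_digit 0 a -> ~ eventually_digit 3 a ->
  digit x = a.
Proof.
move=> ax a0 a3; apply: contrapT => da.
have [dx _] := digit_canonical (expansion_itv ax).
by have [[_ /a0]|[/a3]] := expansion_ambiguous dx ax da.
Qed.

(** * Extreme means, frequencies and the count of digits different from [c] *)

Definition off_digit (c : 'I_4) (a : nat -> 'I_4) (n : nat) : nat :=
  count (predC1 c) (mkseq a n).

Lemma off_digitS c a n : off_digit c a n.+1 = (off_digit c a n + (a n != c))%N.
Proof. by rewrite /off_digit mkseqS -cats1 count_cat /= addn0. Qed.

Lemma digit_countE (R : realType) i (x : R) n :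
  digit_count i x n = count (pred1 i) (mkseq (digit x) n).
Proof.
rewrite /digit_count -sum1_card -sum1_count /mkseq big_map.
have -> : iota 0 n = index_iota 0 n by rewrite /index_iota subn0.
by rewrite big_mkord.
Qed.

(** This is [f n = o(n)], written without division. *)
Definition sparse (R : realType) (f : nat -> nat) :=
  forall e : R, 0 < e -> \forall n \near \oo, (f n)%:R <= e * n%:R.

Definition extreme (c : 'I_4) := c = 0%N :> nat \/ c = 3 :> nat.

(* The summands [e * (a k - c)], with [e] the sign of [3/2 - c], all lie
   in [0, 3]: this one-sidedness is what makes the extreme means special. *)
Lemma off_digit_sum (R : realType) c (a : nat -> 'I_4) : extreme c ->
  exists2 e : R, `|e| = 1 & forall n,
    (off_digit c a n)%:R <= e * (\sum_(k < n) (a k)%:R - n%:R * c%:R)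
      <= 3 * (off_digit c a n)%:R.
Proof.
move=> cE; have [e e1 eP] : exists2 e : R, `|e| = 1 & forall d : 'I_4,
    (d != c)%:R <= e * (d%:R - c%:R) <= 3 * (d != c)%:R.
  case: cE => cE; [exists 1|exists (-1)]; rewrite ?normrN ?normr1// => d;
    rewrite -val_eqE /= cE; case: d => [[|[|[|[|]]]] //] _ /=; lra.
exists e => // n; elim: n => [|n ih].
  by rewrite big_ord0 mul0r subrr !mulr0 lexx.
rewrite off_digitS big_ord_recr /= natrD -[n.+1%:R]natr1 (mulrDr 3).
have -> (s : R) : e * (s + (a n)%:R - (n%:R + 1) * c%:R) =
    e * (s - n%:R * c%:R) + e * ((a n)%:R - c%:R) by ring.
by move/andP: ih => [? ?]; have /andP[? ?] := eP (a n); rewrite !lerD.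
Qed.

(** Multiplied by [n], the distance from the mean to [c] is the one-signed sum of [off_digit_sum],
    hence comparable to [off_digit c a n] up to the factor 3. *)
Lemma mean_extremeP (R : realType) c (a : nat -> 'I_4) : extreme c ->
  (fun n => n%:R^-1 * \sum_(k < n) (a k)%:R) @ \oo --> (c%:R : R) <->
  sparse R (off_digit c a).
Proof.
move=> /(off_digit_sum R a)[e e1 eP].
have bnd n : (0 < n)%N ->
    (off_digit c a n)%:R <=
      n%:R * `|c%:R - n%:R^-1 * \sum_(k < n) (a k)%:R : R|
      <= 3 * (off_digit c a n)%:R.
  move=> n0; have nR : (n%:R : R) != 0 by rewrite pnatr_eq0 -lt0n.
  suff -> : n%:R * `|c%:R - n%:R^-1 * \sum_(k < n) (a k)%:R| =
      e * (\sum_(k < n) (a k)%:R - n%:R * c%:R) :> R by exact: eP.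
  rewrite -[RHS]ger0_norm; last first.
    by have /andP[/(le_trans (ler0n _ _))] := eP n.
  rewrite normrM e1 mul1r -{1}(ger0_norm (ler0n R n)) -normrM -normrN.
  by congr (`|_|); field.
split=> [/cvgrPdist_le mc d d0|sp].
  have := mc _ d0; apply: filter_app; exists 1%N => // n /= n0 h.
  have /andP[+ _] := bnd n n0; move=> /le_trans; apply.
  by rewrite mulrC ler_wpM2r.
apply/cvgrPdist_le => d d0; have d3 : 0 < d / 3 by rewrite divr_gt0.
have := sp _ d3; apply: filter_app; exists 1%N => // n /= n0 h.
have /andP[_ h'] := bnd n n0; have nR : 0 < (n%:R : R) by rewrite ltr0n.
by rewrite -(ler_pM2l nR); lra.
Qed.

(** For [i = c] the count misses [n] by exactly [off_digit c a n]; for any other [i] it is at most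
    that number. *)
Lemma freq_extreme (R : realType) c (a : nat -> 'I_4) i : sparse R (off_digit c a) ->
  (fun n => (count (pred1 i) (mkseq a n))%:R / n%:R) @ \oo --> ((i == c)%:R : R).
Proof.
move=> sp; apply/cvgrPdist_le => d d0.
have := sp _ d0; apply: filter_app; exists 1%N => // n /= n0 h.
have nR : 0 < (n%:R : R) by rewrite ltr0n.
rewrite -(ler_pM2l nR) -{1}(gtr0_norm nR) -normrM mulrBr.
rewrite [X in _ - X]mulrC (divfK (lt0r_neq0 nR)) [leRHS]mulrC.
apply: le_trans h; rewrite /off_digit.
have sz : size (mkseq a n) = n by rewrite size_mkseq.
case: eqVneq => [->|ic].
  by rewrite mulr1 -{1}sz -(count_predC (pred1 c)) natrD addrAC subrr add0r normr_nat.
rewrite mulr0 sub0r normrN normr_nat ler_nat.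
by apply: sub_count => d' /= /eqP ->.
Qed.

(** * Chernoff weights of words and their sums *)

Lemma sum_uniq_sub (R : realType) (T : eqType) (s r : seq T) (F : T -> R) :
    uniq s -> {subset s <= r} -> (forall x, 0 <= F x) ->
  \sum_(x <- s) F x <= \sum_(x <- r) F x.
Proof.
move=> + + F0; elim: s r => [|x s ih] r /=; first by rewrite big_nil sumr_ge0.
case/andP=> xs us sr; rewrite big_cons (big_rem (r := r) x) /=; last first.
  by apply: sr; rewrite mem_head.
rewrite lerD2l; apply: ih => // y ys; apply: rem_mem; last first.
  by apply: sr; rewrite in_cons ys orbT.
by apply: contraNneq xs => <-.
Qed.

Definition words n : seq (seq 'I_4) :=
  iter n (fun ws => [seq d :: w | d <- enum 'I_4, w <- ws]) [:: [::]].

Lemma mem_words (w : seq 'I_4) : w \in words (size w).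
Proof.
elim: w => [|d w ih] /=; first by rewrite mem_seq1.
by apply: allpairs_f => //; rewrite mem_enum.
Qed.

Definition weight (R : realType) (c : 'I_4) (t m : R) (w : seq 'I_4) : R :=
  t ^+ count (predC1 c) w * m ^+ size w.

Lemma weight_ge0 (R : realType) c (t m : R) w :
  0 <= t -> 0 <= m -> 0 <= weight c t m w.
Proof. by move=> t0 m0; rewrite mulr_ge0// exprn_ge0. Qed.

(** The weight is multiplicative over letters: each position contributes [m] for the letter [c] and
    [t * m] for each of the three others. *)
Lemma sum_weight (R : realType) c (t m : R) n :
  \sum_(w <- words n) weight c t m w = ((1 + 3 * t) * m) ^+ n.
Proof.
elim: n => [|n ih]; first by rewrite big_seq1 /weight /= !expr0 mulr1.
rewrite [words _]/= big_allpairs_dep /=.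
under eq_bigr => d _.
  under eq_bigr => w _.
    have -> : weight c t m (d :: w) = t ^+ (d != c) * m * weight c t m w.
      by rewrite /weight /= exprD exprS; ring.
    over.
  rewrite -big_distrr /= ih; over.
rewrite -big_distrl -big_distrl /= exprS; congr (_ * _ * _).
rewrite big_enum /= (bigD1 c) //= eqxx expr0; congr (_ + _).
under eq_bigr => d dc do rewrite dc expr1.
by rewrite sumr_const cardC1 card_ord mulr_natl.
Qed.

(** The long words of [s] are distinct, so they are dominated by all words of lengths from [N] to
    [N + M - 1], whose weights form a geometric sum. *)
Lemma sum_weight_tail (R : realType) c (t m : R) N (s : seq (seq 'I_4)) :
    0 < t -> 0 < m -> (1 + 3 * t) * m < 1 -> uniq s ->
  \sum_(w <- s | (N <= size w)%N) weight c t m w <=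
    ((1 + 3 * t) * m) ^+ N / (1 - (1 + 3 * t) * m).
Proof.
move=> t0 m0; set q := _ * m => q1 us.
have q0 : 0 < q by rewrite mulr_gt0//; lra.
pose M := (\max_(w <- s) size w).+1.
rewrite -big_filter.
apply: (@le_trans _ _
    (\sum_(w <- flatten [seq words k | k <- iota N M]) weight c t m w)).
  apply: sum_uniq_sub; first exact: filter_uniq.
    move=> w; rewrite mem_filter => /andP[Nw ws]; apply/flattenP.
    exists (words (size w)); last exact: mem_words.
    apply: map_f; rewrite mem_iota Nw /= ltn_addl// ltnS.
    by apply: leq_bigmax_seq.
  by move=> w; rewrite weight_ge0// ltW.
rewrite big_flatten big_map -[N]addn0 iotaDl big_map.
under eq_bigr => k _ do rewrite sum_weight -/q exprD.
have := @geometric_le_lim R M (q ^+ N) q; rewrite /series /= /index_iota subn0.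
by rewrite addn0; apply; rewrite ?exprn_ge0 ?ltW// gtr0_norm.
Qed.

(** * Covers by cylinders and dimension zero *)

Definition cylinder (R : realType) (w : seq 'I_4) : set R :=
  [set x | psum R (nth ord0 w) (size w) <= x
           <= psum R (nth ord0 w) (size w) + mesh R (size w)].

Arguments cylinder R w : clear implicits.

Lemma expansion_cylinder (R : realType) (x : R) a n :
  base4_expansion x a -> cylinder R (mkseq a n) x.
Proof.
move=> /expansionP/(_ n); rewrite /cylinder /= size_mkseq.
by rewrite (@eq_psum R (nth ord0 (mkseq a n)) a)// => k kn; rewrite nth_mkseq.
Qed.

Lemma diam_cylinder (R : realType) w :
  (diam (cylinder R w) <= (mesh R (size w))%:E)%E.
Proof.
apply: ge_ereal_sup => _ [x /= /andP[x1 x2] [y /andP[y1 y2] <-]].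
by rewrite lee_fin ler_norml; lra.
Qed.

(** Nonemptiness matters: as a supremum over no pairs, the diameter of [set0] is [-oo]. *)
Lemma diam_ge0 (R : realType) (U : set R) : U !=set0 -> (0 <= diam U)%E.
Proof.
move=> [x Ux]; apply: ereal_sup_ubound => /=.
by exists x => //; exists x => //; rewrite subrr normr0.
Qed.

Lemma mesh_powR (R : realType) n (s : R) : mesh R n `^ s = (4^-1 `^ s) ^+ n.
Proof.
rewrite /mesh -exprVn -powR_mulrn ?invr_ge0// -powRrM mulrC powRrM.
by rewrite powR_mulrn// powR_ge0.
Qed.

Lemma diam_cylinder_powR (R : realType) w (s : R) : 0 <= s ->
    cylinder R w !=set0 ->
  (diam (cylinder R w) `^ s <= ((4^-1 `^ s) ^+ size w)%:E)%E.
Proof.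
move=> s0 /diam_ge0 d0; rewrite -mesh_powR -poweR_EFin.
apply: gt0_ler_poweR => //; rewrite ?in_itv /= ?d0 ?leey//.
  by rewrite lee_fin ltW ?mesh_gt0.
exact: diam_cylinder.
Qed.

Lemma premeasure_le (R : realType) (s delta B : R) (A : set R) (U : nat -> set R) :
    A `<=` \bigcup_i U i -> (forall i, (diam (U i) <= delta%:E)%E) ->
    (forall n, (\sum_(0 <= i < n | U i != set0) diam (U i) `^ s <= B%:E)%E) ->
  (hausdorff_premeasure s delta A <= B%:E)%E.
Proof.
move=> AU Ud UB; apply: ge_ereal_inf.
exists (\sum_(0 <= i <oo | U i != set0) diam (U i) `^ s)%E; first by exists U.
apply: lime_le; last exact: nearW.
by apply: is_cvg_nneseries => n _ _; exact: poweR_ge0.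
Qed.

(** As [l / m < 1], lowering the exponent from [size w] to [K] times the number of letters different
    from [c] increases the power, and [(l / m) ^+ K] is at most [t]. *)
Lemma sparse_weight (R : realType) c (l t m : R) K w :
    0 < l -> l < m -> (l / m) ^+ K <= t -> (K * count (predC1 c) w <= size w)%N ->
  l ^+ size w <= weight c t m w.
Proof.
move=> l0 lm Kt Kw; have m0 := lt_trans l0 lm.
have lm0 : 0 < l / m by rewrite divr_gt0.
have -> : l ^+ size w = (l / m) ^+ size w * m ^+ size w.
  by rewrite -exprMn divfK// gt_eqF.
rewrite /weight ler_wpM2r ?exprn_ge0 ?(ltW m0)//.
apply: (@le_trans _ _ ((l / m) ^+ (K * count (predC1 c) w))).
  by apply: ler_wiXn2l; rewrite ?(ltW lm0)// ler_pdivrMr// mul1r ltW.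
by rewrite exprM lerXn2r// nnegrE ?exprn_ge0 ?(ltW lm0)// (le_trans _ Kt)// exprn_ge0// ltW.
Qed.

Lemma expr_lt_near (R : realType) (q e : R) : 0 <= q -> q < 1 -> 0 < e ->
  \forall n \near \oo, q ^+ n < e.
Proof.
move=> q0 q1 e0; have : `|q| < 1 by rewrite ger0_norm.
move=> /cvg_expr/cvgrPdist_lt/(_ _ e0); apply: filterS => n.
by rewrite sub0r normrN ger0_norm// exprn_ge0.
Qed.

Lemma sparse_premeasure0 (R : realType) c (A : set R) (s delta : R) :
    0 < s -> 0 < delta ->
    (forall x, A x -> exists2 a, base4_expansion x a & sparse R (off_digit c a)) ->
  hausdorff_premeasure s delta A = 0%E.
Proof.
move=> s0 delta0 AP; apply/eqP; rewrite eq_le; apply/andP; split; last first.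
  apply: le_ereal_inf_tmp => _ [U _ <-].
  by apply: nneseries_ge0 => n _ _; exact: poweR_ge0.
apply/lee_addgt0Pr => e e0; rewrite add0e.
pose l : R := 4^-1 `^ s.
have l0 : 0 < l by rewrite powR_gt0// invr_gt0.
have l1 : l < 1.
  have -> : 1 = 1 `^ s :> R by rewrite powR1.
  by apply: gt0_ltr_powR => //; rewrite ?nnegrE//; lra.
(* [m] is the midpoint of [l] and 1; [t] is chosen so that [(1 + 3 * t) * m] is the midpoint of [m]
   and 1. *)
pose m := (l + 1) / 2; pose t := (1 - m) / (6 * m).
have lm : l < m by rewrite /m; lra.
have m1 : m < 1 by rewrite /m; lra.
have m0 : 0 < m := lt_trans l0 lm.
have t0 : 0 < t by rewrite divr_gt0//; lra.
pose q := (1 + 3 * t) * m.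
have qE : q = (1 + m) / 2 by rewrite /q /t; field; rewrite gt_eqF.
have q1 : q < 1 by rewrite qE; lra.
have q0 : 0 <= q by rewrite qE; lra.
have lm1 : l / m < 1 by rewrite ltr_pdivrMr// mul1r.
(* [K.+1] is positive, so its inverse can serve as the rate in [sparse]. *)
have [K _ /(_ K.+1 (leqnSn K)) /= Kt] :=
  expr_lt_near (ltW (divr_gt0 l0 m0)) lm1 t0.
(* The factor [1 - q] cancels the denominator of the geometric tail. *)
have e'0 : 0 < e * (1 - q) by rewrite mulr_gt0//; lra.
have [N [Nq Nd]] : exists N, q ^+ N < e * (1 - q) /\ mesh R N < delta.
  have [N _ /(_ N (leqnn N))] :=
    filterI (expr_lt_near q0 q1 e'0) (mesh_lt delta0).
  by exists N.
pose good w := (N <= size w)%N && (K.+1 * count (predC1 c) w <= size w)%N.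
(* Words are enumerated by their codes; an index coding no good word gets the empty set, which the
   premeasure skips. *)
pose U i := if pickle_inv i is Some w then
  if good w then cylinder R w else set0 else set0.
apply: (@premeasure_le _ _ _ _ _ U).
- move=> x /AP[a ax /(_ (K.+1%:R^-1))].
  rewrite invr_gt0 ltr0n => /(_ isT)[M _ Ma].
  pose n := maxn N M; exists (pickle (mkseq a n)) => //.
  rewrite /U pickleK_inv /good size_mkseq leq_maxl /= ifT.
    exact: expansion_cylinder.
  have := Ma n (leq_maxr _ _); rewrite /= mulrC ler_pdivlMr ?ltr0n//.
  by rewrite -natrM ler_nat mulnC.
- move=> i; rewrite /U; have d0 : (diam (@set0 R) <= delta%:E)%E.
    by apply: ge_ereal_sup => _ [x []].
  case: pickle_inv => // w; case: ifP => // /andP[Nw _].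
  apply: le_trans (diam_cylinder R w) _; rewrite lee_fin.
  apply: le_trans (ltW Nd); have := psum_mesh_homo R (fun=> ord0) Nw.
  have p0 k : psum R (fun=> ord0) k = 0.
    by elim: k => [|k ih]; rewrite ?psum0// psumS ih mul0r addr0.
  by rewrite !p0 !add0r.
move=> n.
pose F w := if (N <= size w)%N then weight c t m w else 0.
have F0 w : 0 <= F w.
  by rewrite /F; case: ifP => // _; rewrite weight_ge0// ltW.
apply: (@le_trans _ _ (\sum_(0 <= i < n) (oapp F 0 (pickle_inv i))%:E)%E).
  rewrite big_mkcond /=; apply: lee_sum => i _.
  case: ifP => [/set0P|_]; last by rewrite lee_fin; case: pickle_inv => //=.
  rewrite /U; case: pickle_inv => [w|[]//] /=.
  case: ifP => [/andP[Nw Kw]|_ [] //] /(diam_cylinder_powR (ltW s0)) h.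
  apply: le_trans h _; rewrite lee_fin /F Nw.
  by apply: (sparse_weight l0 lm (ltW Kt)).
(* The indices that decode give a duplicate-free list of words, so [sum_weight_tail] applies. *)
rewrite sumEFin lee_fin -(@big_pmap _ _ _ _ _ (@pickle_inv (seq 'I_4)) _ F).
rewrite /F -big_mkcond /=.
apply: le_trans (sum_weight_tail _ _ t0 m0 q1 _) _.
  by apply: (pmap_uniq (@pickle_invK _)); rewrite iota_uniq.
by rewrite -/q ler_pdivrMr ?subr_gt0// ltW.
Qed.

Lemma sparse_dim0 (R : realType) c (A : set R) :
    (forall x, A x -> exists2 a, base4_expansion x a & sparse R (off_digit c a)) ->
  hausdorff_dim A = 0%E.
Proof.
move=> AP; apply/eqP; rewrite eq_le; apply/andP; split; last first.
  by apply: le_ereal_inf_tmp => _ [s [s0 _] <-]; rewrite lee_fin.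
apply/lee_addgt0Pr => e e0; rewrite add0e; apply: ereal_inf_lbound.
exists e => //; split; first exact: ltW.
have prem0 d : 0 < d -> hausdorff_premeasure e d A = 0%E.
  by move=> d0; exact: (sparse_premeasure0 e0 d0 AP).
apply/eqP; rewrite eq_le; apply/andP; split.
  by apply: ge_ereal_sup => _ [d d0 <-]; rewrite prem0.
(* Any positive [delta] shows that the supremum is at least 0. *)
by apply: ereal_sup_ubound; exists 1 => //=; rewrite prem0.
Qed.

(** * Infinitely many but rare ranks: the jumps of the binary logarithm *)

Definition log_jump (k : nat) : bool := trunc_log 2 k.+1 != trunc_log 2 k.

(** Summed over ranks, this telescopes: at most [trunc_log 2 k] jumps occur below [k]. *)
Lemma log_jump_le k : (trunc_log 2 k + log_jump k <= trunc_log 2 k.+1)%N.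
Proof.
rewrite /log_jump; have := leq_trunc_log 2 (leqnSn k).
by case: eqVneq => /=; lia.
Qed.

Lemma log_jump_pred m : log_jump (2 ^ m.+1).-1.
Proof.
have m0 : (0 < 2 ^ m)%N by rewrite expn_gt0.
have m1 : (2 ^ m.+1 = 2 * 2 ^ m)%N by rewrite expnS.
rewrite /log_jump prednK ?expn_gt0// trunc_expnK//.
by rewrite (@trunc_log_eq 2 m) //; lia.
Qed.

Lemma log_jumpF m : ~~ log_jump (2 ^ m.+1).
Proof.
have m0 : (0 < 2 ^ m)%N by rewrite expn_gt0.
rewrite /log_jump negbK trunc_expnK// (@trunc_log_eq 2 m.+1) //.
by rewrite !expnS; lia.
Qed.

(** From [m ^ 2 <= 4 * 2 ^ m]. A square-root bound is enough for the logarithm to be [o(n)]. *)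
Lemma trunc_log_sqr n : (0 < n)%N -> (trunc_log 2 n * trunc_log 2 n <= 4 * n)%N.
Proof.
move=> n0; have /andP[] := trunc_log_bounds (isT : (1 < 2)%N) n0.
move: (trunc_log 2 n) => m mn _; apply: leq_trans (leq_mul (leqnn 4) mn).
elim: m {mn} => // -[|[|[|m]]]// ih; rewrite expnS; nia.
Qed.

Lemma sparse_trunc_log (R : realType) : sparse R (trunc_log 2).
Proof.
move=> e e0; have e2 : 0 < e * e by rewrite mulr_gt0.
have h := archi_boundP (ltW (divr_gt0 (ltr0n R 4) e2) : 0 <= 4 / (e * e)).
(* Beyond [4 / (e * e)], a logarithm [L > e * n] would have [L * L > 4 * n]. *)
exists (Num.bound (4 / (e * e))).+1 => // n /= Mn.
have n0 : (0 < n)%N by apply: leq_trans Mn.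
have nR : 0 < (n%:R : R) by rewrite ltr0n.
have en : 4 < n%:R * (e * e).
  by rewrite -ltr_pdivrMr// (lt_trans h)// ltr_nat.
have : (trunc_log 2 n)%:R * (trunc_log 2 n)%:R <= 4 * n%:R :> R.
  by rewrite -!natrM ler_nat trunc_log_sqr.
move: (trunc_log 2 n)%:R => L LL; rewrite leNgt; apply/negP => eL.
have en0 : 0 <= e * n%:R by rewrite mulr_ge0// ltW.
have := ltr_pM en0 en0 eL eL; rewrite -(ltr_pM2l nR) in en.
have -> : e * n%:R * (e * n%:R) = n%:R * (n%:R * (e * e)) by ring.
by lra.
Qed.

(* The rare digits [3 - c] keep the expansion from ending in a period (3) (or (0)),
   in which case [digit] might return the other expansion. *)
Definition sparse_tail (c : 'I_4) (d : nat -> 'I_4) (n k : nat) : 'I_4 :=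
  if (k < n)%N then d k else if log_jump k then rev_ord c else c.

Lemma off_digit_tail c d n k :
  (off_digit c (sparse_tail c d n) k <= n + trunc_log 2 k)%N.
Proof.
(* With [minn n k] the bound grows at each rank of the prefix, so the induction goes through. *)
apply: (@leq_trans (minn n k + trunc_log 2 k)); last by lia.
elim: k => // k ih; rewrite off_digitS {2}/sparse_tail.
have := log_jump_le k; case: ltnP => kn.
  by case: (_ != _) => /=; lia.
by case: log_jump; [case: (_ != _)|rewrite eqxx] => /=; lia.
Qed.

Lemma sparse_off_digit_tail (R : realType) c d n :
  sparse R (off_digit c (sparse_tail c d n)).
Proof.
move=> e e0; have e2 : 0 < e / 2 by rewrite divr_gt0.
have := sparse_trunc_log e2.
have h := archi_boundP (divr_ge0 (ler0n R n) (ltW e2)).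
apply: filter_app; exists (Num.bound (n%:R / (e / 2))) => // k /= Mk lk.
have nk : n%:R < k%:R * (e / 2).
  by rewrite -ltr_pdivrMr// (lt_le_trans h)// ler_nat.
have : (off_digit c (sparse_tail c d n) k)%:R <= n%:R + (trunc_log 2 k)%:R :> R.
  by rewrite -natrD ler_nat off_digit_tail.
by move=> /le_trans; apply; lra.
Qed.

(** Arbitrarily far out, the ranks [2 ^ m.+1 - 1] and [2 ^ m.+1] carry [3 - c] and [c], which differ
    by parity. *)
Lemma sparse_tail_infinite c d n (v : nat) :
  ~ eventually_digit v (sparse_tail c d n).
Proof.
move=> [N Nv]; pose m := (N + n)%N.
have m1 : (m.+1 < 2 ^ m.+1)%N by rewrite ltn_expl.
have := Nv (2 ^ m.+1)%N; have := Nv (2 ^ m.+1).-1.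
rewrite /sparse_tail log_jump_pred (negbTE (log_jumpF m)).
rewrite !ifN; [|lia..] => /= h1 h2.
by have := ltn_ord c; have := h1 ltac:(lia); have := h2 ltac:(lia); lia.
Qed.

(** * Density and dimension of [Theta1] *)

Lemma Theta1_dense (R : realType) c : extreme c ->
  [set x : R | 0 <= x <= 1] `<=` closure (Theta1 (c%:R : R)).
Proof.
move=> cE x x01 B /nbhs_ballP[e /= e0 eB].
have [n _ /(_ n (leqnn n)) /= ne] := mesh_lt e0.
have [dx _] := digit_canonical x01.
pose a := sparse_tail c (digit x) n.
have [y ay] := expansion_cvg R a.
have a_sparse : sparse R (off_digit c a) := @sparse_off_digit_tail R c (digit x) n.
have dy : digit y = a.
  by apply: digit_unique ay _ _; exact: sparse_tail_infinite.
exists y; split; last first.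
  (* [x] and [y] share their first [n] digits, hence a cylinder of length [mesh R n < e]. *)
  apply: eB; rewrite /ball /=.
  have /andP[x1 x2] := (expansionP _ _).1 dx n.
  have /andP[] := (expansionP _ _).1 ay n.
  rewrite (@eq_psum R a (digit x)) => [y1 y2|k kn]; last first.
    by rewrite /a /sparse_tail kn.
  by rewrite ltr_norml; lra.
split; first exact: expansion_itv ay.
- move=> i; apply/cvg_ex; exists (i == c)%:R.
  have -> : digit_freq_seq i y =
      (fun m => (count (pred1 i) (mkseq a m))%:R / m%:R).
    by apply/funext => m; rewrite /digit_freq_seq digit_countE dy.
  exact: freq_extreme.
by rewrite /digit_mean_seq dy; apply/mean_extremeP.
Qed.

Lemma Theta1_dim0 (R : realType) c : extreme c ->
  anomalously_fractal (Theta1 (c%:R : R)).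
Proof.
move=> cE; apply: (@sparse_dim0 _ c) => x [x01 _ mx].
have [dx _] := digit_canonical x01.
by exists (digit x) => //; apply/mean_extremeP.
Qed.

Theorem theorem1 (R : realType) (theta : R) (htheta : theta = 0 \/ theta = 3) :
  anomalously_fractal (Theta1 theta) /\
  [set x : R | 0 <= x <= 1] `<=` closure (Theta1 theta).
Proof.
have [c cE ->] : exists2 c : 'I_4, extreme c & theta = c%:R.
  by case: htheta => ->; [exists ord0|exists ord_max] => //; [left|right].
by split; [exact: Theta1_dim0|exact: Theta1_dense].
Qed.
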